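(* Let $N=1$, let $\alpha>0$ be a constant and $0<T<\infty$. Let $f(x,t)=h/\sqrt t$ with a constant $h>0$, let $D_0=(0,\infty)$ and $u_0\equiv0$. Then there exists a unique bounded solution $(u,S(t))$ on $(0,T)$ (in the sense defined in the context) to $$\partial_t u-\partial_x^2 u=f \ \text{ in } Q_T,\qquad u=0 \ \text{ on } S_T,\qquad \partial u/\partial\nu=-\alpha \ \text{ on } S_T,$$ with initial data $u|_{t=0}=u_0$, $S(t)|_{t=0}=\partial D_0$, satisfying $D(t)=(s(t),\infty)$ with $s(t)=\sigma\sqrt t$ for a constant $\sigma\in\mathbb{R}$. The function $h\mapsto\sigma(h)$ $(h>0)$ is a strictly decreasing smooth function. Moreover, $\sigma(\alpha/\sqrt\pi)=0$, and $\sigma(h)<0$ (resp. $\sigma(h)>0$) if and only if $h>\alpha/\sqrt\pi$ (resp. $h<\alpha/\sqrt\pi$).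
   Context: Notation. $D(t)\subset\mathbb{R}$ are domains with boundary $S(t)=\partial D(t)$; $Q_T=\bigcup_{0<t<T}D(t)\times\{t\}$, $S_T=\bigcup_{0<t<T}S(t)\times\{t\}$; $\partial/\partial\nu$ is the exterior normal derivative of $D(t)$ on $S(t)$, so for $D(t)=(s(t),\infty)$ the boundary conditions read $u(s(t),t)=0$ and $\partial_xu(s(t),t)=\alpha$. A solution is a classical non-negative solution: $u\ge0$ is $C^2$ in $x$ and $C^1$ in $t$ in $Q_T$, with $\partial_x^2u,\partial_tu\in C(Q_T)$ and $u,\partial_xu\in C(Q_T\cup S_T)$, satisfying the equation in $Q_T$ and the boundary conditions on $S_T$; $S_T$ is uniformly $C^{2,1}$ ($C^2$ in space, $C^1$ in time) in $\mathbb{R}\times(\varepsilon,T)$ for every $\varepsilon>0$ (automatic for $s(t)=\sigma\sqrt t$). For the initial value problem one requires in addition that $u$ is bounded and continuous up to $t=0$ on $\overline{D_0}$ with value $u_0$ there (i.e. $u$ extended by $u_0$ on $\overline{D_0}\times\{0\}$ is continuous), and that $S(t)\to\partial D_0$ as $t\downarrow0$ (here: $s(t)\to0$). The constant $\sigma$ is part of the unknown; $\sigma(h)$ denotes the constant $\sigma$ belonging to the unique solution for given $h$ ($\alpha$ being fixed). *)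

(* Defs.v *)
From mathcomp Require Import all_boot all_order all_algebra.
From mathcomp Require Import all_classical all_reals all_analysis.

Set Implicit Arguments.
Unset Strict Implicit.
Unset Printing Implicit Defensive.

Import Order.TTheory GRing.Theory Num.Theory.
Import numFieldNormedType.Exports.

Local Open Scope classical_set_scope.
Local Open Scope ring_scope.

(* One-dimensional free boundary problem on D(t) = (s(t), +oo).  Points of
   space-time are pairs p = (x, t). *)

Definition Ddom (R : realType) (s : R -> R) (t : R) : set R := `]s t, +oo[.

Definition Qdom (R : realType) (s : R -> R) (T : R) : set (R * R) :=
  [set p | 0 < p.2 < T /\ Ddom s p.2 p.1].

(* The boundary of (s(t), +oo) is the single point s(t). *)
Definition Slat (R : realType) (s : R -> R) (T : R) : set (R * R) :=
  [set p | 0 < p.2 < T /\ p.1 = s p.2].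

(* closure(D_0) x {0} with D_0 = (s0, +oo). *)
Definition initial_slice (R : realType) (s0 : R) : set (R * R) :=
  [set p | p.2 = 0 /\ s0 <= p.1].

(* u is a total function, but only its values on Q_T, S_T and
   closure(D_0) x {0} are meaningful. *)
Definition solution_domain (R : realType) (s : R -> R) (T s0 : R) :
    set (R * R) :=
  Qdom s T `|` Slat s T `|` initial_slice s0.

(* S_T is uniformly of class C^1 in t away from t = 0; in one space dimension
   S(t) is a point, so this is all that C^{2,1} regularity asks for. *)
Definition regular_boundary (R : realType) (s : R -> R) (T : R) : Prop :=
  forall eps : R, 0 < eps ->
    [/\ forall t, eps < t < T -> derivable s t 1,
        {in `]eps, T[, continuous (derive1 s)}
      & exists M : R, forall t, eps < t < T -> `|s t| <= M /\ `|derive1 s t| <= M].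

(* ux, uxx, ut are the partial derivatives of u.  On S_T, which is not interior
   to the domain of u, ux is the derivative from inside D(t), i.e. from the
   right. *)
Record classical_derivatives (R : realType) (s : R -> R) (T : R)
    (u ux uxx ut : R * R -> R) : Prop := ClassicalDerivatives {
  cd_ux : forall x t, Qdom s T (x, t) ->
    is_derive x 1 (fun y : R => u (y, t)) (ux (x, t));
  cd_uxx : forall x t, Qdom s T (x, t) ->
    is_derive x 1 (fun y : R => ux (y, t)) (uxx (x, t));
  cd_ut : forall x t, Qdom s T (x, t) ->
    is_derive t 1 (fun r : R => u (x, r)) (ut (x, t));
  cd_ux_bd : forall x t, Slat s T (x, t) ->
    (u (x + e, t) - u (x, t)) / e @[e --> 0^'+] --> ux (x, t);
  cd_uxx_cont : {within Qdom s T, continuous uxx};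
  cd_ut_cont : {within Qdom s T, continuous ut};
  cd_u_cont : {within Qdom s T `|` Slat s T, continuous u};
  cd_ux_cont : {within Qdom s T `|` Slat s T, continuous ux}
}.

(* The exterior unit normal of (s(t), +oo) at s(t) is -1, so the exterior
   normal derivative of u on S_T is - ux. *)
Definition free_boundary_solution (R : realType) (f : R * R -> R) (alpha T : R)
    (s : R -> R) (u : R * R -> R) : Prop :=
  regular_boundary s T /\
  (forall p, Qdom s T p -> 0 <= u p) /\
  exists ux uxx ut : R * R -> R,
    [/\ classical_derivatives s T u ux uxx ut,
        forall p, Qdom s T p -> ut p - uxx p = f p,
        forall p, Slat s T p -> u p = 0
      & forall p, Slat s T p -> - ux p = - alpha].

(* Bounded solution of the initial value problem with D_0 = (s0, +oo) and
   initial value u0. *)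
Definition bounded_ivp_solution (R : realType) (f : R * R -> R) (alpha T : R)
    (s0 : R) (u0 : R -> R) (s : R -> R) (u : R * R -> R) : Prop :=
  [/\ free_boundary_solution f alpha T s u,
      exists M : R, forall p, Qdom s T p -> `|u p| <= M,
      forall x, s0 <= x -> u (x, 0) = u0 x,
      {within solution_domain s T s0, continuous u}
    & s t @[t --> 0^'+] --> s0].

Definition smooth_on (R : realType) (A : set R) (g : R -> R) : Prop :=
  forall (n : nat) (x : R), A x -> derivable (derive1n n g) x 1.

(* Main.v *)
Require Import Defs.
From mathcomp Require Import all_boot all_order all_algebra.
From mathcomp Require Import all_classical all_reals all_analysis.
From mathcomp Require Import ring lra.

(** The scaling [u (x, t) = sqrt t * phi (x / sqrt t)] turns the heat equation
with source [h / sqrt t] into [phi / 2 - xi * phi' / 2 - phi'' = h].  Its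
constant solution is [2 * h], and the solutions of the homogeneous equation
that stay bounded at [+oo] are the multiples of
[I xi = 2 * g xi - xi * E xi], where [g xi = exp (- xi ^ 2 / 4)] and [E] is
the tail integral of [g] over [[xi, +oo[]; moreover [I' = - E] and [E' = - g].
Vanishing at [xi = sigma] forces [phi xi = 2 * h * (1 - I xi / I sigma)], and
the slope there is [2 * h * E sigma / I sigma].  The slope condition is
therefore the scalar equation [F sigma = 2 * h / alpha] with [F = I / E].

The function [F] is a strictly decreasing bijection onto the positive reals.
Monotonicity is the strict log-concavity [I * g < E ^ 2] of [I]
([gauss_tail_logconcave]): each inequality of this kind says that a function
with negative derivative stays above its limit [0] at [+oo].  Surjectivity
follows from [- xi < F xi] and, for positive [xi], [F xi < 2 / xi].  Since
[F 0 = 2 / sqrt pi], the sign of [sigma] changes at [h = alpha / sqrt pi].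
Eliminating [g] gives [F' = - 1 + F * (F + xi) / 2], so that the derivative
of [F^-1] is a rational function of the variable and of [F^-1] itself, with
no zero in the denominator; smoothness follows by induction
([smooth_on_generator], [smooth_tail_ratio_inv]).

For uniqueness, fix the constant [sigma'] of an arbitrary bounded solution.
The maximum principle on the unbounded domain ([heat_max_principle]) shows
that the Dirichlet problem on [x > sigma' * sqrt t] has a single bounded
solution, which is hence the similarity solution attached to [sigma'].  Its
boundary slope being [alpha], [F sigma' = 2 * h / alpha], and injectivity of
[F] determines [sigma']. *)

Set Implicit Arguments.
Unset Strict Implicit.
Unset Printing Implicit Defensive.

Import Order.TTheory GRing.Theory Num.Theory.
Import numFieldNormedType.Exports.

Local Open Scope classical_set_scope.
Local Open Scope ring_scope.

(** * One-variable calculus *)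

Lemma is_derive1_continuous (R : realType) (f : R -> R) (x l : R) :
  is_derive x 1 f l -> {for x, continuous f}.
Proof.
by move=> df; apply/differentiable_continuous/derivable1_diffP; case: df.
Qed.

Lemma is_derive1_MVT (R : realType) (f df : R -> R) (a b : R) : a < b ->
  (forall x, a <= x <= b -> is_derive x 1 f (df x)) ->
  exists2 c, a < c < b & f b - f a = df c * (b - a).
Proof.
move=> ab fdf.
have [||c] := @MVT R f df a b ab.
- by move=> x; rewrite in_itv/= => /andP[ax xb]; apply: fdf; rewrite !ltW.
- apply: continuous_in_subspaceT => y /set_mem; rewrite /= in_itv/= => yab.
  by apply: is_derive1_continuous; apply: fdf.
- by rewrite in_itv/= => cab fE; exists c.
Qed.

Lemma derive1_lt0_decr (R : realType) (f df : R -> R) (a : R) :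
  (forall x, a < x -> is_derive x 1 f (df x)) ->
  (forall x, a < x -> df x < 0) ->
  forall x y, a < x -> x < y -> f y < f x.
Proof.
move=> fdf df0 x y ax xy.
have [z /andP[az _]|c /andP[xc _] fE] := @is_derive1_MVT R f df x y xy.
  by apply: fdf; exact: lt_le_trans az.
rewrite -subr_lt0 fE pmulr_llt0 ?subr_gt0//.
by apply: df0; exact: lt_trans xc.
Qed.

(** A strictly decreasing function lies strictly above its limit; this is how
every inequality between the Gaussian tails below is obtained. *)
Lemma derive1_lt0_cvg0_gt0 (R : realType) (f df : R -> R) (a : R) :
  (forall x, a < x -> is_derive x 1 f (df x)) ->
  (forall x, a < x -> df x < 0) ->
  f x @[x --> +oo] --> 0 -> forall x, a < x -> 0 < f x.
Proof.
move=> fdf df0 f0 x ax.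
have decr := derive1_lt0_decr fdf df0.
apply: (@le_lt_trans _ _ (f (x + 1))); last first.
  by apply: decr => //; rewrite ltrDl.
apply: (cvgr_to_le f0).
near=> y; apply/ltW/decr; first by rewrite (lt_trans ax)// ltrDl.
by near: y; apply: nbhs_pinfty_gt; rewrite num_real.
Unshelve. all: by end_near. Qed.

(** The form in which one-sided derivatives on the free boundary are required. *)
Lemma is_derive1_right_quotient (R : realType) (f : R -> R) (x a : R) :
  is_derive x 1 f a -> (f (x + e) - f x) / e @[e --> 0^'+] --> a.
Proof.
move=> /is_derive1_caratheodory[g [fE gc <-]].
have h : g (x + e) @[e --> 0^'+] --> g x.
  apply: cvg_at_right_filter.
  rewrite -[X in _ --> g X]addr0.
  apply: (@continuous_comp _ _ _ (fun e => x + e) g).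
    by apply: cvgD; [exact: cvg_cst|exact: cvg_id].
  by rewrite addr0.
apply: cvg_trans h; apply: near_eq_cvg.
near=> e; rewrite fE addrAC subrr add0r mulfK//.
Unshelve. all: by end_near. Qed.

Lemma derive1_left_max_ge0 (R : realType) (f : R -> R) (x a : R) :
  is_derive x 1 f a -> (\forall z \near x, z < x -> f z <= f x) -> 0 <= a.
Proof.
move=> /is_derive1_caratheodory[g [fE gc <-]] fmax; rewrite leNgt; apply/negP => g0.
have gn : \forall z \near x, g z < 0 by exact: (cvgr_lt _ gc).
have [e /= e0 xe] := (nbhs_ballP _ _).1 (filterI gn fmax).
have [|gz fz] := xe (x - e / 2).
  by rewrite /ball/= opprB addrC subrK gtr0_norm ?divr_gt0// gtr_pMr// invf_lt1// ltr1n.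
move: fz; rewrite -subr_le0 fE addrAC subrr sub0r.
have e2 : 0 < e / 2 by rewrite divr_gt0.
by rewrite gtrBl => /(_ e2); rewrite nmulr_rle0// oppr_ge0 leNgt e2.
Qed.

Lemma derive1_right_max_le0 (R : realType) (f : R -> R) (x a : R) :
  is_derive x 1 f a -> (\forall z \near x, x < z -> f z <= f x) -> a <= 0.
Proof.
move=> /is_derive1_caratheodory[g [fE gc <-]] fmax; rewrite leNgt; apply/negP => g0.
have gn : \forall z \near x, 0 < g z by exact: (cvgr_gt _ gc).
have [e /= e0 xe] := (nbhs_ballP _ _).1 (filterI gn fmax).
have e2 : 0 < e / 2 by rewrite divr_gt0.
have [|gz fz] := xe (x + e / 2).
  by rewrite /ball/= opprD addrA subrr sub0r normrN gtr0_norm// gtr_pMr// invf_lt1// ltr1n.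
move: fz; rewrite -subr_le0 fE addrAC subrr add0r.
by rewrite ltrDl => /(_ e2); rewrite pmulr_rle0// leNgt e2.
Qed.

(** At a maximum the first derivative vanishes; were the second one positive,
the first would be positive just to the right and the function would increase
there. *)
Lemma derive2_max_le0 (R : realType) (f df : R -> R) (x a : R) :
  (\forall z \near x, is_derive (z : R) 1 f (df z)) -> is_derive x 1 df a ->
  (\forall z \near x, f z <= f x) -> a <= 0.
Proof.
move=> fdf ddf fmax.
have dfx := nbhs_singleton fdf.
have df0 : df x = 0.
  apply/le_anti/andP; split.
    by apply: derive1_right_max_le0 dfx _; apply: filterS fmax.
  by apply: derive1_left_max_ge0 dfx _; apply: filterS fmax.
move: ddf => /is_derive1_caratheodory[g [dfE gc <-]].
rewrite leNgt; apply/negP => g0.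
have gn : \forall z \near x, 0 < g z by exact: (cvgr_gt _ gc).
have [e /= e0 xe] := (nbhs_ballP _ _).1 (filterI (filterI gn fmax) fdf).
have e2 : 0 < e / 2 by rewrite divr_gt0.
have xye z : x <= z <= x + e / 2 -> ball x e z.
  move=> /andP[xz zy]; rewrite /ball/= distrC ger0_norm ?subr_ge0// ltrBlDl.
  by apply: le_lt_trans zy _; rewrite ltrD2l gtr_pMr// invf_lt1// ltr1n.
have xy : x < x + e / 2 by rewrite ltrDl.
have [z zxy|c /andP[xc cy] fE] := @is_derive1_MVT R f df x (x + e / 2) xy.
  by have [] := xe z (xye z zxy).
have /xe[[_ fy] _] : ball x e (x + e / 2) by apply: xye; rewrite lexx ltW.
have /xe[[gc0 _] _] : ball x e c by apply: xye; rewrite !ltW.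
move: fy; rewrite -subr_le0 fE addrAC subrr add0r leNgt => /negP; apply.
apply: mulr_gt0 => //.
by rewrite -[df c]subr0 -[X in _ - X]df0 dfE mulr_gt0// subr_gt0.
Qed.

(** A class of functions stable under differentiation consists of smooth
functions: on an open set every iterated derivative coincides with a member of
the class. *)
Lemma smooth_on_closed (R : realType) (A : set R) (C : set (R -> R)) : open A ->
  (forall f, C f -> exists2 df, C df & forall x, A x -> is_derive x 1 f (df x)) ->
  forall f, C f -> smooth_on A f.
Proof.
move=> oA clC f Cf n.
suff [g Cg fg] : exists2 g, C g & forall x, A x -> derive1n n f x = g x.
  move=> x Ax; have [dg _ gdg] := clC g Cg.
  have gfx : {near x, g =1 derive1n n f}.
    by apply: filterS (open_nbhs_nbhs (conj oA Ax)) => y /fg.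
  by apply: near_eq_derivable gfx _ => //; case: (gdg x Ax).
elim: n => [|n [g Cg fg]]; first by exists f.
have [dg Cdg gdg] := clC g Cg; exists dg => // x Ax.
rewrite derive1nS derive1E.
have gfx : {near x, derive1n n f =1 g}.
  by apply: filterS (open_nbhs_nbhs (conj oA Ax)) => y /fg.
rewrite (near_eq_derive _ gfx)//.
by case: (gdg x Ax).
Qed.

(** The ring of polynomial expressions in the functions of [G]. *)
Inductive ring_generated (R : realType) (G : set (R -> R)) : set (R -> R) :=
| RGcst c : ring_generated G (cst c)
| RGgen f : G f -> ring_generated G f
| RGadd f g : ring_generated G f -> ring_generated G g ->
    ring_generated G (fun x => f x + g x)
| RGmul f g : ring_generated G f -> ring_generated G g ->
    ring_generated G (fun x => f x * g x).

(** By the Leibniz rule it suffices to differentiate the generators: the whole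
ring is then stable under differentiation. *)
Lemma smooth_on_generator (R : realType) (A : set R) (G : set (R -> R)) : open A ->
  (forall f, G f -> exists2 df, ring_generated G df &
     forall x, A x -> is_derive x 1 f (df x)) ->
  forall f, G f -> smooth_on A f.
Proof.
move=> oA clG f0 Gf0.
apply: (smooth_on_closed oA _ (RGgen Gf0)).
move=> f; elim=> {f} [c|g|g1 g2 G1 [d1 Gd1 g1d1] G2 [d2 Gd2 g2d2]|
    g1 g2 G1 [d1 Gd1 g1d1] G2 [d2 Gd2 g2d2]].
- by exists (cst 0) => [|x _]; [exact: RGcst|exact: is_derive_cst].
- exact: clG.
- exists (fun x => d1 x + d2 x); first exact: RGadd.
  by move=> x Ax; apply: is_deriveD; [exact: g1d1|exact: g2d2].
- exists (fun x => g1 x * d2 x + g2 x * d1 x).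
    by apply: RGadd; exact: RGmul.
  by move=> x Ax; apply: is_deriveM; [exact: g1d1|exact: g2d2].
Qed.

(** * Gaussian tails *)

Definition gauss_primitive (R : realType) (x : R) : R :=
  (\int[lebesgue_measure]_(t in `]-oo, x]) gauss_fun t)%R.

Lemma is_derive_gauss_primitive (R : realType) (x : R) :
  is_derive x 1 (@gauss_primitive R) (gauss_fun x).
Proof.
have ig : lebesgue_measure.-integrable `]-oo, (x + 1)%R] (EFin \o @gauss_fun R).
  by apply: (integrableS _ _ _ integrableT_gauss).
have [|df dfE] := continuous_FTC1 _ ig (ltNyr x) (continuous_gauss_fun (x := x)).
- by rewrite ltrDl.
by split; [exact: df|rewrite -derive1E].
Qed.

(** The limit exists because the primitive is nondecreasing and bounded by the
full integral; the half-line Gauss integral gives its value. *)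
Lemma gauss_primitive_cvg (R : realType) :
  gauss_primitive x @[x --> +oo] -->
    gauss_primitive 0 + Num.sqrt (@pi R) / 2.
Proof.
have nd : nondecreasing_fun (@gauss_primitive R).
  move=> x y; rewrite le_eqVlt => /predU1P[->//|xy].
  have [z _|c _ E] := @is_derive1_MVT R (@gauss_primitive R) (@gauss_fun R) _ _ xy.
    exact: is_derive_gauss_primitive.
  by rewrite -subr_ge0 E mulr_ge0 ?gauss_fun_ge0// subr_ge0 ltW.
have ub : has_ubound (range (@gauss_primitive R)).
  exists (fine (\int[lebesgue_measure]_x (gauss_fun x)%:E)%E) => _ [x _ <-].
  rewrite /gauss_primitive /Rintegral; apply: fine_le.
  - apply: integrable_fin_num => //.
    by apply: (integrableS _ _ _ integrableT_gauss).
  - by apply: integrable_fin_num => //; exact: integrableT_gauss.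
  - apply: ge0_subset_integral => //.
      by have /integrableP[] := @integrableT_gauss R.
    by move=> y _; rewrite lee_fin gauss_fun_ge0.
have cv := nondecreasing_cvgr nd ub.
set l := sup _ in cv.
have : (\int[lebesgue_measure]_(x in `[0%R, +oo[) (gauss_fun x)%:E)%E =
    (l%:E - (gauss_primitive (0 : R))%:E)%E.
  apply: ge0_continuous_FTC2y => //.
  - by move=> x _; exact: gauss_fun_ge0.
  - by apply: continuous_subspaceT; exact: continuous_gauss_fun.
  - by move=> x _; case: (is_derive_gauss_primitive x).
  - apply: cvg_at_right_filter.
    by apply: is_derive1_continuous; exact: is_derive_gauss_primitive.
  - by move=> x _; rewrite derive1E; case: (is_derive_gauss_primitive x).
rewrite integral0y_gauss -EFinB => -[->].
by rewrite addrC subrK.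
Qed.

Definition heat_gauss (R : realType) (x : R) : R := expR (- (x ^+ 2 / 4)).

(** The integral of [heat_gauss] over [[x, +oo[], after the substitution
[y = 2 * z] in the standard Gaussian: [gauss_primitive 0 + sqrt pi / 2] is the
total mass. *)
Definition gauss_tail (R : realType) (x : R) : R :=
  Num.sqrt (@pi R) + 2 * gauss_primitive 0 - 2 * gauss_primitive (x / 2).

(** The integral of [gauss_tail] over [[x, +oo[], in the closed form given by
integration by parts. *)
Definition gauss_tail2 (R : realType) (x : R) : R :=
  2 * heat_gauss x - x * gauss_tail x.

Lemma heat_gauss_gt0 (R : realType) (x : R) : 0 < heat_gauss x.
Proof. exact: expR_gt0. Qed.

Lemma is_derive_heat_gauss (R : realType) (x : R) :
  is_derive x 1 (@heat_gauss R) (- (x / 2) * heat_gauss x).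
Proof.
have d : is_derive x 1 (fun y : R => - (y ^+ 2 / 4)) (- (x / 2)).
  by apply: is_derive_eq; rewrite /GRing.scale/=; field.
rewrite mulrC.
exact: (@is_derive1_comp R expR (fun y => - (y ^+ 2 / 4))).
Qed.

Lemma is_derive_gauss_tail (R : realType) (x : R) :
  is_derive x 1 (@gauss_tail R) (- heat_gauss x).
Proof.
have d : is_derive x 1 (fun y : R => gauss_primitive (y / 2))
    (gauss_fun (x / 2) * 2^-1).
  have d2 : is_derive x 1 (fun y : R => y / 2) 2^-1.
    by apply: is_derive_eq; rewrite /GRing.scale/=; field.
  apply: (@is_derive1_comp R (@gauss_primitive R) (fun y => y / 2)).
  exact: is_derive_gauss_primitive.
rewrite /gauss_tail.
apply: is_derive_eq; rewrite /GRing.scale/=.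
rewrite (_ : heat_gauss x = gauss_fun (x / 2)); first by field.
by rewrite /heat_gauss /gauss_fun; congr (expR (- _)); field.
Qed.

Lemma is_derive_gauss_tail2 (R : realType) (x : R) :
  is_derive x 1 (@gauss_tail2 R) (- gauss_tail x).
Proof.
have d1 := is_derive_heat_gauss x; have d2 := is_derive_gauss_tail x.
rewrite /gauss_tail2.
by apply: is_derive_eq; rewrite /GRing.scale/=; field.
Qed.

Lemma gauss_tail0 (R : realType) : gauss_tail 0 = Num.sqrt (@pi R).
Proof. by rewrite /gauss_tail mul0r addrK. Qed.

Lemma gauss_tail2_0 (R : realType) : gauss_tail2 0 = 2 :> R.
Proof. by rewrite /gauss_tail2 mul0r subr0 /heat_gauss expr0n/= mul0r oppr0 expR0 mulr1. Qed.

Lemma cvg_gauss_tail (R : realType) : gauss_tail x @[x --> +oo] --> (0 : R).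
Proof.
rewrite /gauss_tail.
rewrite [X in _ --> X](_ : _ = Num.sqrt (@pi R) + 2 * gauss_primitive 0 -
  2 * (gauss_primitive 0 + Num.sqrt (@pi R) / 2)); last by field.
apply: cvgB; first exact: cvg_cst.
apply: cvgM; first exact: cvg_cst.
apply: (cvg_comp (fun x => x / 2) (@gauss_primitive R)); last exact: gauss_primitive_cvg.
by apply: gt0_cvgMly.
Qed.

(** The inequality [y <= expR y], squared at [y = x ^+ 2 / 8], bounds the
product by [64 / x ^+ 2], hence by [64 / x] for [x > 1]. *)
Lemma cvg_sqr_heat_gauss (R : realType) :
  x ^+ 2 * heat_gauss x @[x --> +oo] --> (0 : R).
Proof.
have inv0 : 64 * x^-1 @[x --> +oo] --> (0 : R).
  rewrite -[X in _ --> X](mulr0 64); apply: cvgM; first exact: cvg_cst.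
  apply/gtr0_cvgV0; last exact: cvg_id.
  by apply: nbhs_pinfty_gt; rewrite num_real.
apply: squeeze_cvgr (cvg_cst 0) inv0.
near=> x.
have x1 : 1 < x by near: x; apply: nbhs_pinfty_gt; rewrite num_real.
rewrite mulr_ge0 ?sqr_ge0 ?(ltW (heat_gauss_gt0 _))//=.
have e : x ^+ 2 / 8 <= expR (x ^+ 2 / 8).
  by apply: le_trans (expR_ge1Dx _); rewrite lerDr.
have E : expR (x ^+ 2 / 4) = expR (x ^+ 2 / 8) ^+ 2.
  by rewrite -expRM_natl; congr expR; field.
rewrite /heat_gauss expRN ler_pdivrMr ?expR_gt0// E.
have e2 : (x ^+ 2 / 8) ^+ 2 <= expR (x ^+ 2 / 8) ^+ 2.
  by rewrite lerXn2r ?nnegrE ?expR_ge0// divr_ge0 ?sqr_ge0.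
apply: (@le_trans _ _ (64 * x^-1 * (x ^+ 2 / 8) ^+ 2)).
  rewrite (_ : 64 * _ * _ = x ^+ 2 * x); last by field; lra.
  by rewrite ler_peMr ?sqr_ge0// ltW.
by rewrite ler_pM2l// mulr_gt0// invr_gt0; lra.
Unshelve. all: by end_near. Qed.

Lemma norm_le_cvg0 (R : realType) (f g : R -> R) :
  g x @[x --> +oo] --> (0 : R) ->
  (forall x, 1 < x -> `|f x| <= g x) -> f x @[x --> +oo] --> (0 : R).
Proof.
move=> g0 fg; apply/norm_cvg0P.
apply: squeeze_cvgr (cvg_cst 0) g0.
near=> x; rewrite normr_ge0/=; apply: fg.
by near: x; apply: nbhs_pinfty_gt; rewrite num_real.
Unshelve. all: by end_near. Qed.

Lemma gauss_tail_gt0 (R : realType) (x : R) : 0 < gauss_tail x.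
Proof.
apply: (@derive1_lt0_cvg0_gt0 R (@gauss_tail R) (fun y => - heat_gauss y) (x - 1)).
- by move=> y _; exact: is_derive_gauss_tail.
- by move=> y _; rewrite oppr_lt0 heat_gauss_gt0.
- exact: cvg_gauss_tail.
- by rewrite gtrBl.
Qed.

(** For [x > 1] the lower powers are dominated by the square. *)
Lemma cvg_monom_heat_gauss (R : realType) (k : nat) : (k <= 2)%N ->
  x ^+ k * heat_gauss x @[x --> +oo] --> (0 : R).
Proof.
move=> k2; apply: norm_le_cvg0 (@cvg_sqr_heat_gauss R) _ => x x1.
rewrite ger0_norm ?mulr_ge0 ?exprn_ge0 ?(ltW (heat_gauss_gt0 _))//; last lra.
by rewrite ler_pM2r ?heat_gauss_gt0// ler_weXn2l// ltW.
Qed.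

Lemma cvg_heat_gauss (R : realType) : heat_gauss x @[x --> +oo] --> (0 : R).
Proof.
rewrite -[X in X @ _ --> _](_ : (fun x => x ^+ 0 * heat_gauss x) = _).
  exact: cvg_monom_heat_gauss.
by apply/funext => x; rewrite expr0 mul1r.
Qed.

(** The difference has derivative [(1 - x) * heat_gauss x].  The bound transfers
the decay of the Gaussian to its tail. *)
Lemma gauss_tail_lt (R : realType) (x : R) : 1 < x ->
  gauss_tail x < 2 * heat_gauss x.
Proof.
move=> x1; rewrite -subr_gt0.
pose f (y : R) := 2 * heat_gauss y - gauss_tail y.
apply: (@derive1_lt0_cvg0_gt0 R f (fun y => (1 - y) * heat_gauss y) 1) x1.
- move=> y y1; have d1 := is_derive_heat_gauss y.
  have d2 := is_derive_gauss_tail y.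
  by apply: is_derive_eq; rewrite /GRing.scale/=; field.
- by move=> y y1; rewrite nmulr_rlt0 ?heat_gauss_gt0// subr_lt0.
- rewrite /f -[X in _ --> X](subr0 0); apply: cvgB; last exact: cvg_gauss_tail.
  rewrite -[X in _ --> X](mulr0 2); apply: cvgM; first exact: cvg_cst.
  exact: cvg_heat_gauss.
Qed.

Lemma cvg_monom_gauss_tail (R : realType) (k : nat) : (k <= 2)%N ->
  x ^+ k * gauss_tail x @[x --> +oo] --> (0 : R).
Proof.
move=> k2; have h : 2 * (x ^+ 2 * heat_gauss x) @[x --> +oo] --> (0 : R).
  rewrite -[X in _ --> X](mulr0 2); apply: cvgM; first exact: cvg_cst.
  exact: cvg_sqr_heat_gauss.
apply: norm_le_cvg0 h _ => x x1.
rewrite ger0_norm ?mulr_ge0 ?exprn_ge0 ?(ltW (gauss_tail_gt0 _))//; last lra.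
rewrite mulrCA; apply: ler_pM.
- by rewrite exprn_ge0//; lra.
- exact/ltW/gauss_tail_gt0.
- by rewrite ler_weXn2l// ltW.
- exact/ltW/gauss_tail_lt.
Qed.

Lemma cvg_gauss_tail2 (R : realType) : gauss_tail2 x @[x --> +oo] --> (0 : R).
Proof.
rewrite /gauss_tail2 -[X in _ --> X](subrr 0); apply: cvgB.
  rewrite -[X in _ --> X](mulr0 2); apply: cvgM; first exact: cvg_cst.
  exact: cvg_heat_gauss.
exact: (@cvg_monom_gauss_tail R 1).
Qed.

Lemma gauss_tail2_gt0 (R : realType) (x : R) : 0 < gauss_tail2 x.
Proof.
apply: (@derive1_lt0_cvg0_gt0 R (@gauss_tail2 R) (fun y => - gauss_tail y) (x - 1)).
- by move=> y _; exact: is_derive_gauss_tail2.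
- by move=> y _; rewrite oppr_lt0 gauss_tail_gt0.
- exact: cvg_gauss_tail2.
- by rewrite gtrBl.
Qed.

Lemma gauss_tail2_decr (R : realType) (x y : R) : x < y ->
  gauss_tail2 y < gauss_tail2 x.
Proof.
apply: (@derive1_lt0_decr R _ (fun z => - gauss_tail z) (x - 1)).
- by move=> z _; exact: is_derive_gauss_tail2.
- by move=> z _; rewrite oppr_lt0 gauss_tail_gt0.
- by rewrite gtrBl.
Qed.

(** The difference has derivative [- gauss_tail2 x]. *)
Lemma gauss_tail_gt_mul_tail2 (R : realType) (x : R) :
  x / 2 * gauss_tail2 x < gauss_tail x.
Proof.
rewrite -subr_gt0.
pose f (y : R) := gauss_tail y - y / 2 * gauss_tail2 y.
apply: (@derive1_lt0_cvg0_gt0 R f (fun y => - gauss_tail2 y) (x - 1)).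
- move=> y _; have d1 := is_derive_gauss_tail y.
  have d2 := is_derive_gauss_tail2 y.
  by apply: is_derive_eq; rewrite /GRing.scale/= /gauss_tail2; field.
- by move=> y _; rewrite oppr_lt0 gauss_tail2_gt0.
- rewrite /f; have -> : (fun y : R => gauss_tail y - y / 2 * gauss_tail2 y) =
     (fun y => y ^+ 0 * gauss_tail y - y ^+ 1 * heat_gauss y
       + 2^-1 * (y ^+ 2 * gauss_tail y)).
    by apply/funext => y; rewrite /gauss_tail2; field.
  rewrite -[X in _ --> X](addr0 0); apply: cvgD.
    rewrite -[X in _ --> X](subrr 0); apply: cvgB.
      exact: cvg_monom_gauss_tail.
    exact: cvg_monom_heat_gauss.
  rewrite -[X in _ --> X](mulr0 2^-1); apply: cvgM; first exact: cvg_cst.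
  exact: cvg_monom_gauss_tail.
- by rewrite gtrBl.
Qed.

(** Strict log-concavity of [gauss_tail2], whose first two derivatives are
[- gauss_tail] and [heat_gauss].  The difference of the two sides has derivative
[- heat_gauss x * (gauss_tail x - x / 2 * gauss_tail2 x)], negative by
[gauss_tail_gt_mul_tail2]. *)
Lemma gauss_tail_logconcave (R : realType) (x : R) :
  gauss_tail2 x * heat_gauss x < gauss_tail x ^+ 2.
Proof.
rewrite -subr_gt0.
pose f (y : R) := gauss_tail y ^+ 2 - gauss_tail2 y * heat_gauss y.
apply: (@derive1_lt0_cvg0_gt0 R f
  (fun y => - (heat_gauss y * (gauss_tail y - y / 2 * gauss_tail2 y))) (x - 1)).
- move=> y _; have d0 := is_derive_heat_gauss y.
  have d1 := is_derive_gauss_tail y; have d2 := is_derive_gauss_tail2 y.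
  by apply: is_derive_eq; rewrite /GRing.scale/=; field.
- move=> y _; rewrite oppr_lt0 mulr_gt0 ?heat_gauss_gt0// subr_gt0.
  exact: gauss_tail_gt_mul_tail2.
- rewrite /f -[X in _ --> X](subrr 0); apply: cvgB.
    rewrite -[X in _ --> X](mulr0 0).
    by apply: cvgM; exact: cvg_gauss_tail.
  rewrite -[X in _ --> X](mulr0 0).
  apply: cvgM; first exact: cvg_gauss_tail2.
  exact: cvg_heat_gauss.
- by rewrite gtrBl.
Qed.

(** * The quotient of the tails and its inverse *)

(** The similarity solution with free boundary [sigma * sqrt t] and source
[h / sqrt t] has boundary slope [2 * h / tail_ratio sigma]. *)
Definition tail_ratio (R : realType) (x : R) : R := gauss_tail2 x / gauss_tail x.

(** The derivative of [tail_ratio] at [x], written through [x] and the value [c]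
of [tail_ratio] there; the Gaussian is eliminated by
[2 * heat_gauss x = gauss_tail2 x + x * gauss_tail x]. *)
Definition dtail_ratio (R : realType) (x c : R) : R := - 1 + c * (c + x) / 2.

Lemma is_derive_tail_ratio (R : realType) (x : R) :
  is_derive x 1 (@tail_ratio R) (dtail_ratio x (tail_ratio x)).
Proof.
have T0 : gauss_tail x != 0 by rewrite gt_eqF// gauss_tail_gt0.
have d1 := is_derive_gauss_tail x; have d2 := is_derive_gauss_tail2 x.
have dV := is_deriveV T0 d1.
apply: is_derive_eq; rewrite /GRing.scale/= /dtail_ratio /tail_ratio /gauss_tail2.
by field.
Qed.

Lemma dtail_ratio_lt0 (R : realType) (x : R) : dtail_ratio x (tail_ratio x) < 0.
Proof.
have T0 := gauss_tail_gt0 x.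
have -> : dtail_ratio x (tail_ratio x) =
    (gauss_tail2 x * heat_gauss x - gauss_tail x ^+ 2) / gauss_tail x ^+ 2.
  rewrite /dtail_ratio /tail_ratio /gauss_tail2; field.
  by rewrite gt_eqF.
by rewrite pmulr_llt0 ?invr_gt0 ?exprn_gt0// subr_lt0 gauss_tail_logconcave.
Qed.

Lemma tail_ratio_decr (R : realType) (x y : R) : x < y ->
  tail_ratio y < tail_ratio x.
Proof.
apply: (@derive1_lt0_decr R _ (fun z => dtail_ratio z (tail_ratio z)) (x - 1)).
- by move=> z _; exact: is_derive_tail_ratio.
- by move=> z _; exact: dtail_ratio_lt0.
- by rewrite gtrBl.
Qed.

Lemma tail_ratio_lt (R : realType) (x y : R) :
  (tail_ratio y < tail_ratio x) = (x < y).
Proof.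
apply/idP/idP; last exact: tail_ratio_decr.
by apply: contraTT; rewrite -!leNgt le_eqVlt => /predU1P[->//|/tail_ratio_decr/ltW].
Qed.

Lemma tail_ratio_inj (R : realType) : injective (@tail_ratio R).
Proof.
move=> x y xy; apply/eqP; case: ltgtP => // /tail_ratio_decr; by rewrite xy ltxx.
Qed.

Lemma tail_ratio0 (R : realType) : tail_ratio 0 = 2 / Num.sqrt (@pi R).
Proof. by rewrite /tail_ratio gauss_tail2_0 gauss_tail0. Qed.

(** Intermediate values between [- c] and [2 / c], from [- x < tail_ratio x] and
[tail_ratio x < 2 / x] for positive [x]. *)
Lemma tail_ratio_surj (R : realType) (c : R) : 0 < c ->
  exists x, tail_ratio x = c.
Proof.
move=> c0; have T0 := @gauss_tail_gt0 R.
have ab : - c < 2 / c :> R.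
  by apply: (@lt_trans _ _ 0); rewrite ?oppr_lt0// divr_gt0.
have Fa : c < tail_ratio (- c).
  rewrite /tail_ratio ltr_pdivlMr// /gauss_tail2 mulNr opprK ltrDr.
  by rewrite mulr_gt0 ?heat_gauss_gt0.
have Fb : tail_ratio (2 / c) < c.
  rewrite /tail_ratio ltr_pdivrMr//.
  have := gauss_tail_gt_mul_tail2 (2 / c).
  rewrite -(ltr_pM2l c0); congr (_ < _); field; by rewrite gt_eqF.
have [||x _ xc] := @IVT R (@tail_ratio R) (- c) (2 / c) c (ltW ab).
- apply: continuous_subspaceT => x.
  exact: is_derive1_continuous (is_derive_tail_ratio x).
- by rewrite ge_min le_max (ltW Fa) (ltW Fb) orbT.
by exists x.
Qed.

Definition tail_ratio_inv (R : realType) (c : R) : R :=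
  xget 0 [set x | tail_ratio x = c].

Lemma tail_ratio_invK (R : realType) (c : R) : 0 < c ->
  tail_ratio (tail_ratio_inv c) = c.
Proof.
move=> /tail_ratio_surj [x xc]; rewrite /tail_ratio_inv.
by case: xgetP => [y _ //|/(_ x)].
Qed.

Lemma tail_ratioK (R : realType) : cancel (@tail_ratio R) (@tail_ratio_inv R).
Proof.
move=> x; apply: tail_ratio_inj; apply: tail_ratio_invK.
by rewrite divr_gt0 ?gauss_tail2_gt0 ?gauss_tail_gt0.
Qed.

Lemma is_derive_tail_ratio_inv (R : realType) (c : R) : 0 < c ->
  is_derive c 1 (@tail_ratio_inv R) (dtail_ratio (tail_ratio_inv c) c)^-1.
Proof.
move=> c0; have dF := is_derive_tail_ratio (tail_ratio_inv c).
have dF0 := dtail_ratio_lt0 (tail_ratio_inv c).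
rewrite tail_ratio_invK// in dF dF0.
rewrite -[X in is_derive X](tail_ratio_invK c0).
apply: is_derive_inverse dF _.
- by near=> x; exact: tail_ratioK.
- by near=> x; exact: is_derive1_continuous (is_derive_tail_ratio x).
- by rewrite lt_eqF.
Unshelve. all: by end_near. Qed.

(** The functions [id], the inverse [s] and its derivative [w] generate a ring
stable under differentiation, because [w = k / D] with [D] a polynomial in [id]
and [s], so that [w'] is [- (w ^ 2 / k) * D']. *)
Lemma smooth_tail_ratio_inv (R : realType) (k : R) : 0 < k ->
  smooth_on [set h | 0 < h] (fun h => tail_ratio_inv (k * h)).
Proof.
move=> k0; pose s (h : R) : R := tail_ratio_inv (k * h).
pose D (h : R) : R := dtail_ratio (s h) (k * h).
pose w (h : R) : R := k / D h.
pose G := [set f | f = id \/ f = s \/ f = w].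
have ds (h : R) : 0 < h -> is_derive h 1 s (w h).
  move=> h0; have kh : 0 < k * h by rewrite mulr_gt0.
  have d1 := is_derive_tail_ratio_inv kh.
  have d2 : is_derive h 1 (fun y => k * y) k.
    by apply: is_derive_eq; rewrite /GRing.scale/=; ring.
  rewrite /w mulrC.
  exact: (@is_derive1_comp R (@tail_ratio_inv R) (fun y => k * y)).
have D0 (h : R) : 0 < h -> D h != 0.
  move=> h0; have := dtail_ratio_lt0 (s h).
  by rewrite tail_ratio_invK ?mulr_gt0// => /lt_eqF ->.
pose dD (h : R) : R := (k * (k * h + s h) + k * h * (k + w h)) / 2.
have dDE (h : R) : 0 < h -> is_derive h 1 D (dD h).
  move=> h0; have d1 := ds h h0; rewrite /D /dtail_ratio.
  by apply: is_derive_eq; rewrite /dD /GRing.scale/=; field.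
pose dw (h : R) : R := - k^-1 * (w h * w h) * dD h.
have dwE (h : R) : 0 < h -> is_derive h 1 w (dw h).
  move=> h0; have d1 := dDE h h0; have d2 := is_deriveV (D0 h h0) d1.
  rewrite {1}/w; apply: is_derive_eq; rewrite /dw /w /GRing.scale/=; field.
  by rewrite D0// gt_eqF.
apply: (@smooth_on_generator R _ G); last by right; left.
  exact: open_gt.
have Gid : ring_generated G id by apply: RGgen; left.
have Gs : ring_generated G s by apply: RGgen; right; left.
have Gw : ring_generated G w by apply: RGgen; right; right.
have Gc c : ring_generated G (fun=> c) := RGcst G c.
move=> _ [->|[->|->]].
- by exists (cst 1) => [|x _]; [exact: Gc|exact: is_derive_id].
- by exists w.
- exists dw => //; rewrite /dw /dD.
  by repeat first [exact: Gid | exact: Gs | exact: Gw | exact: Gc |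
    apply: RGmul | apply: RGadd].
Qed.

(** * The maximum principle for the heat equation *)

(** The perturbation [v = w - eps * x ^+ 2 - 3 * eps * t] makes a subsolution strict
and pushes it below zero for large [x], so that a positive maximum would be
attained at a point with [v_t >= 0 >= v_xx].  The factor [3] exceeds the second
derivative [2] of [x ^+ 2], whence [v_t < v_xx] everywhere. *)
Lemma heat_max_principle (R : realType) (s : R -> R) (T s0 M : R)
    (w wx wxx wt : R * R -> R) :
  continuous s -> s 0 = s0 ->
  (forall x t, Qdom s T (x, t) -> is_derive x 1 (fun y => w (y, t)) (wx (x, t))) ->
  (forall x t, Qdom s T (x, t) -> is_derive x 1 (fun y => wx (y, t)) (wxx (x, t))) ->
  (forall x t, Qdom s T (x, t) -> is_derive t 1 (fun r => w (x, r)) (wt (x, t))) ->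
  (forall p, Qdom s T p -> wt p - wxx p <= 0) ->
  (forall p, Qdom s T p -> w p <= M) ->
  (forall p, Slat s T p -> w p <= 0) ->
  (forall p, initial_slice s0 p -> w p <= 0) ->
  {within solution_domain s T s0, continuous w} ->
  forall p, Qdom s T p -> w p <= 0.
Proof.
move=> cs s0E dwx dwxx dwt weq wM wS w0 wc [x0 t0] Q0.
have [/= /andP[t00 t0T] x0s] := Q0.
rewrite leNgt; apply/negP => wp0.
(* [eps] makes [v (x0, t0)] half of the value assumed positive. *)
pose N := x0 ^+ 2 + 3 * t0.
have N0 : 0 < N by rewrite ltr_wpDl ?sqr_ge0// mulr_gt0.
pose eps := w (x0, t0) / (2 * N).
have eps0 : 0 < eps by rewrite divr_gt0// mulr_gt0.
pose v (p : R * R) := w p - (eps * p.1 ^+ 2 + 3 * eps * p.2).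
have vp0 : 0 < v (x0, t0).
  rewrite (_ : v _ = w (x0, t0) / 2); first by rewrite divr_gt0.
  by rewrite /v/= /eps /N; field; rewrite gt_eqF.
clearbody eps.
have [tm _ sm] := EVT_min (ltW t00) (continuous_subspaceT cs).
(* [X] is so large that [M < eps * X <= eps * X ^+ 2]. *)
pose X := 1 + `|x0| + `|M| / eps.
pose K := [set p : R * R | s p.2 <= p.1] `&` (`[s tm, X] `*` `[0, t0]).
have KsD : K `<=` solution_domain s T s0.
  move=> [x t] [/= sx [/= _]]; rewrite in_itv/= => /andP[t0' tt0].
  move: t0'; rewrite le_eqVlt => /predU1P[t0'|t0'].
    by right; split => //=; rewrite -s0E t0'.
  have tT : 0 < t < T by rewrite t0' (le_lt_trans tt0).
  move: sx; rewrite le_eqVlt => /predU1P[sx|sx]; left; [right|left] => //.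
  by split => //; rewrite /Ddom/= in_itv/= sx.
have cK : compact K.
  rewrite /K setIC; apply: compact_closedI.
    by apply: compact_setX; exact: segment_compact.
  rewrite (_ : mkset _ = (fun p : R * R => p.1 - s p.2) @^-1` [set x | 0 <= x]).
    apply: closed_comp; last exact: closed_ge.
    move=> p _; apply: cvgB; first exact: cvg_fst.
    by apply: continuous_comp; [exact: cvg_snd|exact: cs].
  by apply/seteqP; split => p /=; rewrite subr_ge0.
have xX : x0 < X.
  rewrite (le_lt_trans (ler_norm _))// /X addrAC ltrDr.
  by rewrite ltr_pwDl// divr_ge0// ltW.
have K0 : K (x0, t0).
  split => /=; first by move: x0s; rewrite /Ddom/= in_itv/= andbT => /ltW.
  split; rewrite /= in_itv/=; last by rewrite lexx ltW.
  rewrite (ltW xX) andbT; apply: (@le_trans _ _ (s t0)).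
    by apply: sm; rewrite in_itv/= lexx ltW.
  by move: x0s; rewrite /Ddom/= in_itv/= andbT => /ltW.
have vc : {within K, continuous v}.
  have h : continuous (fun p : R * R => eps * p.1 ^+ 2 + 3 * eps * p.2).
    move=> p; apply: cvgD; apply: cvgM; try exact: cvg_cst; last exact: cvg_snd.
    by apply: cvgM; exact: cvg_fst.
  have wK := continuous_subspaceW KsD wc.
  have hK : {within K, continuous _} := continuous_subspaceT h.
  by move=> p; apply: cvgB; [exact: wK|exact: hK].
have [[x1 t1] /set_mem K1 vmax] := compact_EVT_max (ex_intro _ _ K0) cK vc.
have v1 : 0 < v (x1, t1) by apply: lt_le_trans vp0 (vmax _ (mem_set K0)).
have /= w1 : 0 < w (x1, t1).
  apply: lt_le_trans v1 _; rewrite /v/= lerBlDr lerDl.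
  have t1_ge0 : 0 <= t1 by case: K1 => _ [/= _]; rewrite in_itv/= => /andP[].
  have e_ge0 := ltW eps0.
  apply: addr_ge0; first by rewrite mulr_ge0// sqr_ge0.
  by apply: mulr_ge0 => //; rewrite mulr_ge0.
have Q1 : Qdom s T (x1, t1).
  have [[//|/wS]|/w0] := KsD _ K1; by rewrite leNgt w1.
have [sx1 [/= x1X t1t0]] := K1.
have [/= /andP[t10 t1T]] := Q1; rewrite /Ddom/= in_itv/= andbT => s1x1.
have {}x1X : x1 < X.
  move: x1X; rewrite in_itv/= => /andP[_]; rewrite le_eqVlt => /predU1P[x1X|//].
  have : v (x1, t1) < 0; last by rewrite ltNge ltW.
  rewrite /v /= subr_lt0; apply: (le_lt_trans (wM _ Q1)).
  have X1 : 1 <= X by rewrite /X -addrA lerDl addr_ge0// divr_ge0// ltW.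
  apply: (le_lt_trans (ler_norm M)).
  apply: (@lt_le_trans _ _ (eps * X)).
    rewrite /X mulrDr mulrC [eps * (_ / _)]mulrC divfK ?gt_eqF// ltrDr.
    by rewrite mulr_gt0// ltr_pwDl.
  rewrite x1X -[leLHS]addr0 lerD//; last by rewrite !mulr_ge0// ltW.
  by rewrite ler_pM2l// expr2 ler_peMl// (le_trans _ X1).
have t1le : t1 <= t0 by move: t1t0; rewrite in_itv/= => /andP[].
have smX : s tm <= s t1.
  by apply: sm; rewrite in_itv/= t1le ltW.
(* Being interior in space and at a positive time, the maximum dominates its
   spatial neighbours and, at the same place, the immediately earlier times. *)
have Kx : \forall x \near x1, s t1 < x /\ x <= X.
  apply: filterI; first exact: lt_nbhsr.
  by apply: filterS (lt_nbhsl x1X) => x /ltW.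
have Kt : \forall t \near t1, 0 < t /\ s t < x1.
  apply: filterI; first exact: lt_nbhsr.
  exact: (cvgr_lt _ (cs t1)).
have vxx : wxx (x1, t1) - 2 * eps <= 0.
  apply: (@derive2_max_le0 R (fun x => v (x, t1))
    (fun x => wx (x, t1) - 2 * eps * x) x1).
  - apply: filterS Kx => x [sx _].
    have d : is_derive x 1 (fun y => w (y, t1)) (wx (x, t1)).
      by apply: dwx; split => /=; [rewrite t10|rewrite /Ddom/= in_itv/= sx].
    by rewrite /v/=; apply: is_derive_eq; rewrite /GRing.scale/=; ring.
  - have d := dwxx _ _ Q1.
    by apply: is_derive_eq; rewrite /GRing.scale/=; ring.
  - apply: filterS Kx => x [sx xX']; apply: vmax; apply/mem_set.
    split => /=; first exact: ltW.
    by split => //=; rewrite in_itv/= xX' (le_trans smX)// ltW.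
have vt : 0 <= wt (x1, t1) - 3 * eps.
  apply: (@derive1_left_max_ge0 R (fun t => v (x1, t)) t1).
    have d := dwt _ _ Q1.
    by rewrite /v/=; apply: is_derive_eq; rewrite /GRing.scale/=; ring.
  apply: filterS Kt => t [tpos sx] tt1; apply: vmax; apply/mem_set.
  split => /=; first exact: ltW.
  split => /=; rewrite in_itv/=; last by rewrite (ltW tpos) (le_trans (ltW tt1)).
  by rewrite (ltW x1X) (le_trans smX)// ltW.
by have := weq _ Q1; lra.
Qed.

(** Comparison for the Dirichlet problem: the maximum principle applied to the
difference, which solves the homogeneous equation. *)
Lemma heat_dirichlet_le (R : realType) (f : R * R -> R) (s : R -> R) (T s0 : R)
    (u1 u1x u1xx u1t u2 u2x u2xx u2t : R * R -> R) :
  continuous s -> s 0 = s0 ->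
  classical_derivatives s T u1 u1x u1xx u1t ->
  classical_derivatives s T u2 u2x u2xx u2t ->
  (forall p, Qdom s T p -> u1t p - u1xx p = f p) ->
  (forall p, Qdom s T p -> u2t p - u2xx p = f p) ->
  (exists M, forall p, Qdom s T p -> `|u1 p| <= M) ->
  (exists M, forall p, Qdom s T p -> `|u2 p| <= M) ->
  (forall p, Slat s T p -> u1 p <= u2 p) ->
  (forall p, initial_slice s0 p -> u1 p <= u2 p) ->
  {within solution_domain s T s0, continuous u1} ->
  {within solution_domain s T s0, continuous u2} ->
  forall p, Qdom s T p -> u1 p <= u2 p.
Proof.
move=> cs s0E D1 D2 eq1 eq2 [M1 b1] [M2 b2] uS u0 c1 c2 p Qp.
rewrite -subr_le0.
apply: (@heat_max_principle R s T s0 (M1 + M2) (fun p => u1 p - u2 p)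
  (fun p => u1x p - u2x p) (fun p => u1xx p - u2xx p)
  (fun p => u1t p - u2t p)) Qp => //.
- by move=> x t Q; apply: is_deriveB; [exact: (cd_ux D1)|exact: (cd_ux D2)].
- by move=> x t Q; apply: is_deriveB; [exact: (cd_uxx D1)|exact: (cd_uxx D2)].
- by move=> x t Q; apply: is_deriveB; [exact: (cd_ut D1)|exact: (cd_ut D2)].
- by move=> q Q; have := eq1 q Q; have := eq2 q Q; lra.
- move=> q Q; apply: lerD; first exact: le_trans (ler_norm _) (b1 q Q).
  by apply: le_trans (b2 q Q); rewrite -normrN ler_norm.
- by move=> q /uS; rewrite subr_le0.
- by move=> q /u0; rewrite subr_le0.
- by move=> q; apply: cvgB; [exact: c1|exact: c2].
Qed.

(** * Similarity solutions *)

(** The profile [2 * h * (1 - gauss_tail2 xi / gauss_tail2 sigma)] is the bounded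
solution of the equation satisfied by self-similar solutions that vanishes at
[xi = sigma]. *)
Definition similarity_solution (R : realType) (h sigma : R) (p : R * R) : R :=
  Num.sqrt p.2 *
    (2 * h - 2 * h / gauss_tail2 sigma * gauss_tail2 (p.1 / Num.sqrt p.2)).

Definition similarity_solution_x (R : realType) (h sigma : R) (p : R * R) : R :=
  2 * h / gauss_tail2 sigma * gauss_tail (p.1 / Num.sqrt p.2).

Definition similarity_solution_xx (R : realType) (h sigma : R) (p : R * R) : R :=
  - (2 * h / gauss_tail2 sigma * heat_gauss (p.1 / Num.sqrt p.2) / Num.sqrt p.2).

Definition similarity_solution_t (R : realType) (h sigma : R) (p : R * R) : R :=
  similarity_solution_xx h sigma p + h / Num.sqrt p.2.

Lemma is_derive_divr (R : realType) (q x : R) : is_derive x 1 (fun y => y / q) q^-1.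
Proof. by apply: is_derive_eq; rewrite /GRing.scale/=; ring. Qed.

Lemma similarity_solution_dx (R : realType) (h sigma x t : R) : 0 < t ->
  is_derive x 1 (fun y => similarity_solution h sigma (y, t))
    (similarity_solution_x h sigma (x, t)).
Proof.
move=> t0; have q0 : Num.sqrt t != 0 by rewrite gt_eqF// sqrtr_gt0.
have d := @is_derive1_comp R (@gauss_tail2 R) _ x _ _
  (is_derive_gauss_tail2 _) (is_derive_divr (Num.sqrt t) x).
rewrite /similarity_solution /similarity_solution_x /=.
apply: is_derive_eq; rewrite /GRing.scale/=; field.
by rewrite q0 gt_eqF// gauss_tail2_gt0.
Qed.

Lemma similarity_solution_dxx (R : realType) (h sigma x t : R) : 0 < t ->
  is_derive x 1 (fun y => similarity_solution_x h sigma (y, t))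
    (similarity_solution_xx h sigma (x, t)).
Proof.
move=> t0; have q0 : Num.sqrt t != 0 by rewrite gt_eqF// sqrtr_gt0.
have d := @is_derive1_comp R (@gauss_tail R) _ x _ _
  (is_derive_gauss_tail _) (is_derive_divr (Num.sqrt t) x).
rewrite /similarity_solution_xx /similarity_solution_x /=.
apply: is_derive_eq; rewrite /GRing.scale/=; field.
by rewrite q0 gt_eqF// gauss_tail2_gt0.
Qed.

(** The time derivative produces [(phi - xi * phi') / 2] over [sqrt t]; expanding
[gauss_tail2] leaves only the constant [h] and the Gaussian term of [phi'']. *)
Lemma similarity_solution_dt (R : realType) (h sigma x t : R) : 0 < t ->
  is_derive t 1 (fun r => similarity_solution h sigma (x, r))
    (similarity_solution_t h sigma (x, t)).
Proof.
move=> t0; have q0 : Num.sqrt t != 0 by rewrite gt_eqF// sqrtr_gt0.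
have ds := is_derive1_sqrt t0; have dV := is_deriveV q0 ds.
have dxi : is_derive t 1 (fun r => x / Num.sqrt r)
    (- x * Num.sqrt t ^- 2 * (2 * Num.sqrt t)^-1).
  by apply: is_derive_eq; rewrite /GRing.scale/=; ring.
have d := @is_derive1_comp R (@gauss_tail2 R) _ t _ _ (is_derive_gauss_tail2 _) dxi.
rewrite /similarity_solution /similarity_solution_t /similarity_solution_xx /=.
apply: is_derive_eq; rewrite /GRing.scale/=.
move: (gauss_tail2 sigma) (gauss_tail2_gt0 sigma) => S S0.
by rewrite /gauss_tail2; field; rewrite q0 gt_eqF.
Qed.

Lemma continuous_sqrt_snd (R : realType) : continuous (fun p : R * R => Num.sqrt p.2).
Proof. by move=> p; apply: continuous_comp; [exact: cvg_snd|exact: sqrt_continuous]. Qed.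

Lemma continuous_comp_similarity (R : realType) (F : R -> R) (p : R * R) :
  continuous F -> 0 < p.2 ->
  {for p, continuous (fun p : R * R => F (p.1 / Num.sqrt p.2))}.
Proof.
move=> cF p0; apply: (@continuous_comp _ _ _ (fun p : R * R => p.1 / Num.sqrt p.2) F).
  apply: cvgM; first exact: cvg_fst.
  by apply: cvgV; [rewrite gt_eqF// sqrtr_gt0|exact: continuous_sqrt_snd].
exact: cF.
Qed.

Lemma continuous_similarity_solution (R : realType) (h sigma : R) (p : R * R) :
  0 < p.2 -> {for p, continuous (similarity_solution h sigma)}.
Proof.
move=> p0; apply: cvgM; first exact: continuous_sqrt_snd.
apply: cvgB; first exact: cvg_cst.
apply: cvgM; first exact: cvg_cst.
apply: continuous_comp_similarity => // x.
exact: is_derive1_continuous (is_derive_gauss_tail2 x).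
Qed.

Lemma continuous_similarity_solution_x (R : realType) (h sigma : R) (p : R * R) :
  0 < p.2 -> {for p, continuous (similarity_solution_x h sigma)}.
Proof.
move=> p0; apply: cvgM; first exact: cvg_cst.
apply: continuous_comp_similarity => // x.
exact: is_derive1_continuous (is_derive_gauss_tail x).
Qed.

Lemma continuous_similarity_solution_xx (R : realType) (h sigma : R) (p : R * R) :
  0 < p.2 -> {for p, continuous (similarity_solution_xx h sigma)}.
Proof.
move=> p0; apply: cvgN; apply: cvgM.
  apply: cvgM; first exact: cvg_cst.
  apply: continuous_comp_similarity => // x.
  exact: is_derive1_continuous (is_derive_heat_gauss x).
by apply: cvgV; [rewrite gt_eqF// sqrtr_gt0|exact: continuous_sqrt_snd].
Qed.

Lemma continuous_similarity_solution_t (R : realType) (h sigma : R) (p : R * R) :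
  0 < p.2 -> {for p, continuous (similarity_solution_t h sigma)}.
Proof.
move=> p0; apply: cvgD; first exact: continuous_similarity_solution_xx.
apply: cvgM; first exact: cvg_cst.
by apply: cvgV; [rewrite gt_eqF// sqrtr_gt0|exact: continuous_sqrt_snd].
Qed.

Lemma similarity_solution_derivatives (R : realType) (T h sigma : R) :
  classical_derivatives (fun t => sigma * Num.sqrt t) T
    (similarity_solution h sigma) (similarity_solution_x h sigma)
    (similarity_solution_xx h sigma) (similarity_solution_t h sigma).
Proof.
have QSpos p : (Qdom (fun t => sigma * Num.sqrt t) T `|`
    Slat (fun t => sigma * Num.sqrt t) T) p -> 0 < p.2.
  by case=> -[/andP[]].
split.
- by move=> x t [/andP[t0 _] _]; exact: similarity_solution_dx.
- by move=> x t [/andP[t0 _] _]; exact: similarity_solution_dxx.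
- by move=> x t [/andP[t0 _] _]; exact: similarity_solution_dt.
- move=> x t [/andP[t0 _] _].
  apply: (is_derive1_right_quotient (f := fun y => similarity_solution h sigma (y, t))).
  exact: similarity_solution_dx.
- apply: continuous_in_subspaceT => p /set_mem Qp.
  by apply: continuous_similarity_solution_xx; apply: QSpos; left.
- apply: continuous_in_subspaceT => p /set_mem Qp.
  by apply: continuous_similarity_solution_t; apply: QSpos; left.
- apply: continuous_in_subspaceT => p /set_mem Qp.
  by apply: continuous_similarity_solution; exact: QSpos.
- apply: continuous_in_subspaceT => p /set_mem Qp.
  by apply: continuous_similarity_solution_x; exact: QSpos.
Qed.

(** The profile increases from [0] at [sigma] to [2 * h] at infinity. *)
Lemma similarity_solution_bounds (R : realType) (h sigma : R) (p : R * R) :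
  0 < h -> 0 < p.2 -> sigma * Num.sqrt p.2 <= p.1 ->
  0 <= similarity_solution h sigma p <= Num.sqrt p.2 * (2 * h).
Proof.
case: p => x t /= h0 t0 sx; have q0 : 0 < Num.sqrt t by rewrite sqrtr_gt0.
have S0 := gauss_tail2_gt0 sigma.
have c0 : 0 < 2 * h / gauss_tail2 sigma by rewrite divr_gt0// mulr_gt0.
rewrite /similarity_solution /= pmulr_rge0// ler_pM2l// subr_ge0 gerBl.
have S1 := gauss_tail2_gt0 (x / Num.sqrt t).
apply/andP; split; last by rewrite mulr_ge0// ltW.
rewrite mulrAC ler_pdivrMr// ler_pM2l ?mulr_gt0//.
move: sx; rewrite -ler_pdivlMr// le_eqVlt => /predU1P[->//|sx].
exact/ltW/gauss_tail2_decr.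
Qed.

Lemma similarity_solution_lateral (R : realType) (T h sigma : R) (p : R * R) :
  Slat (fun t => sigma * Num.sqrt t) T p ->
  similarity_solution h sigma p = 0 /\
  similarity_solution_x h sigma p = 2 * h / tail_ratio sigma.
Proof.
case: p => x t [/= /andP[t0 _] ->]; have q0 : 0 < Num.sqrt t by rewrite sqrtr_gt0.
rewrite /similarity_solution /similarity_solution_x /= mulfK ?gt_eqF//.
rewrite mulfVK ?gt_eqF ?gauss_tail2_gt0// subrr mulr0; split => //.
by rewrite /tail_ratio invf_div mulrA mulrAC.
Qed.

(** At positive times this is composition of continuous functions; at the initial
time [x / sqrt t] has no limit, and the factor [sqrt t] against the bounded
profile gives continuity. *)
Lemma similarity_solution_within (R : realType) (T h sigma : R) : 0 < h ->
  {within solution_domain (fun t => sigma * Num.sqrt t) T 0,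
    continuous (similarity_solution h sigma)}.
Proof.
move=> h0; apply/subspace_continuousP => -[x t] Dp; rewrite /from_subspace.
have [t0|t0] := ltP 0 t.
  by apply: cvg_within_filter; exact: continuous_similarity_solution.
have {t0}t0 : t = 0.
  by case: Dp => [[]|] [] //= /andP[]; rewrite ltNge t0.
rewrite [X in _ --> X](_ : _ = 0); last first.
  by rewrite /similarity_solution /= t0 sqrtr0 mul0r.
apply/norm_cvg0P.
have g0 : Num.sqrt q.2 * (2 * h) @[q --> ((x, t) : R * R)] --> 0.
  rewrite -(mul0r (2 * h)); apply: cvgM; last exact: cvg_cst.
  by have := @continuous_sqrt_snd R (x, t); rewrite /continuous_at /= t0 sqrtr0.
apply: squeeze_cvgr (cvg_cst 0) (cvg_within_filter _ g0).
near=> q; have Dq : solution_domain (fun t => sigma * Num.sqrt t) T 0 q.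
  by near: q; exact: withinT.
rewrite normr_ge0 /=.
have [[/andP[q0 _] sx]|[q0 _]] : (0 < q.2 < T /\ sigma * Num.sqrt q.2 <= q.1) \/
    initial_slice 0 q; last 2 first.
- have /andP[u0 u1] := similarity_solution_bounds h0 q0 sx.
  by rewrite ger0_norm.
- by rewrite /similarity_solution q0 sqrtr0 !mul0r normr0.
case: Dq => [[[q0 qs]|[q0 qs]]|]; [left|left|by right]; split => //.
  by move: qs; rewrite /Ddom/= in_itv/= andbT => /ltW.
by rewrite qs.
Unshelve. all: by end_near. Qed.

Lemma similarity_solution_initial (R : realType) (h sigma : R) (p : R * R) :
  p.2 = 0 -> similarity_solution h sigma p = 0.
Proof. by move=> p0; rewrite /similarity_solution p0 sqrtr0 mul0r. Qed.

Lemma similarity_solution_bounded (R : realType) (T h sigma : R) : 0 < h ->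
  forall p, Qdom (fun t => sigma * Num.sqrt t) T p ->
    0 <= similarity_solution h sigma p <= Num.sqrt T * (2 * h).
Proof.
move=> h0 p [/andP[p0 pT]]; rewrite /Ddom/= in_itv/= andbT => sp.
have /andP[-> u1] := similarity_solution_bounds h0 p0 (ltW sp).
by rewrite (le_trans u1)// ler_pM2r ?mulr_gt0// ler_wsqrtr// ltW.
Qed.

Lemma regular_boundary_sqrt (R : realType) (T sigma : R) :
  regular_boundary (fun t => sigma * Num.sqrt t) T.
Proof.
have ds (t : R) : 0 < t ->
    is_derive t 1 (fun t => sigma * Num.sqrt t) (sigma * (2 * Num.sqrt t)^-1).
  move=> t0; have d := is_derive1_sqrt t0.
  by apply: is_derive_eq; rewrite /GRing.scale/=; ring.
have dsE (t : R) : 0 < t ->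
    derive1 (fun t => sigma * Num.sqrt t) t = sigma * (2 * Num.sqrt t)^-1.
  by move=> t0; rewrite derive1E; case: (ds t t0).
move=> eps eps0; split.
- by move=> t /andP[te _]; case: (ds t (lt_trans eps0 te)).
- move=> t; rewrite in_itv/= => /andP[te _]; have t0 := lt_trans eps0 te.
  rewrite /continuous_at dsE//.
  have h : sigma * (2 * Num.sqrt r)^-1 @[r --> t] --> sigma * (2 * Num.sqrt t)^-1.
    apply: cvgM; first exact: cvg_cst.
    apply: cvgV; first by rewrite gt_eqF// mulr_gt0// sqrtr_gt0.
    by apply: cvgM; [exact: cvg_cst|exact: sqrt_continuous].
  apply: cvg_trans h; apply: near_eq_cvg.
  by apply: filterS (lt_nbhsr t0) => r /dsE.
- exists (`|sigma| * Num.sqrt T + `|sigma| * (2 * Num.sqrt eps)^-1).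
  move=> t /andP[te tT]; have t0 := lt_trans eps0 te; rewrite dsE// !normrM.
  have q0 : 0 < Num.sqrt eps by rewrite sqrtr_gt0.
  have p1 : `|Num.sqrt t| <= Num.sqrt T.
    by rewrite ger0_norm ?sqrtr_ge0// ler_wsqrtr// ltW.
  have p2 : `|(2 * Num.sqrt t)^-1| <= (2 * Num.sqrt eps)^-1.
    rewrite ger0_norm ?invr_ge0 ?mulr_ge0 ?sqrtr_ge0//.
    rewrite lef_pV2 ?posrE ?mulr_gt0 ?sqrtr_gt0// ler_pM2l// ler_wsqrtr//.
    exact: ltW.
  have A0 : 0 <= `|sigma| * Num.sqrt T by rewrite mulr_ge0// sqrtr_ge0.
  have B0 : 0 <= `|sigma| * (2 * Num.sqrt eps)^-1.
    by rewrite mulr_ge0// invr_ge0 mulr_ge0// ltW.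
  split; [apply: le_trans (ler_wpM2l _ p1) _|apply: le_trans (ler_wpM2l _ p2) _] => //.
    by rewrite lerDl.
  by rewrite lerDr.
Qed.

(** * The free boundary problem *)

Lemma similarity_solution_sol (R : realType) (alpha T h sigma : R) :
  0 < alpha -> 0 < h -> tail_ratio sigma = 2 * h / alpha ->
  bounded_ivp_solution (fun p => h / Num.sqrt p.2) alpha T 0 (fun=> 0)
    (fun t => sigma * Num.sqrt t) (similarity_solution h sigma).
Proof.
move=> a0 h0 sE; split.
- split; first exact: regular_boundary_sqrt.
  split; first by move=> p /(similarity_solution_bounded h0)/andP[].
  exists (similarity_solution_x h sigma), (similarity_solution_xx h sigma),
    (similarity_solution_t h sigma); split.
  + exact: similarity_solution_derivatives.
  + by move=> p _; rewrite /similarity_solution_t addrAC subrr add0r.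
  + by move=> p /(similarity_solution_lateral h)[].
  + move=> p /(similarity_solution_lateral h)[_ ->]; rewrite sE; congr (- _).
    by field; rewrite !gt_eqF.
- exists (Num.sqrt T * (2 * h)) => p /(similarity_solution_bounded h0)/andP[u0 u1].
  by rewrite ger0_norm.
- by move=> x _; exact: similarity_solution_initial.
- exact: similarity_solution_within.
- apply: cvg_at_right_filter; rewrite -[X in _ --> X](mulr0 sigma).
  apply: cvgM; first exact: cvg_cst.
  by rewrite -[X in _ --> X]sqrtr0; exact: sqrt_continuous.
Qed.

(** For a prescribed boundary the Dirichlet data determine the bounded solution,
by comparison in both directions. *)
Lemma similarity_solution_unique (R : realType) (alpha T h sigma : R)
    (u : R * R -> R) : 0 < h ->
  bounded_ivp_solution (fun p => h / Num.sqrt p.2) alpha T 0 (fun=> 0)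
    (fun t => sigma * Num.sqrt t) u ->
  forall p, solution_domain (fun t => sigma * Num.sqrt t) T 0 p ->
    u p = similarity_solution h sigma p.
Proof.
move=> h0 [[_ [_ [ux [uxx [ut [du eu uS _]]]]]] bu u0 cu _].
have dv := similarity_solution_derivatives T h sigma.
have ev p : Qdom (fun t => sigma * Num.sqrt t) T p ->
    similarity_solution_t h sigma p - similarity_solution_xx h sigma p =
    h / Num.sqrt p.2.
  by move=> _; rewrite /similarity_solution_t addrAC subrr add0r.
have bv : exists M, forall p, Qdom (fun t => sigma * Num.sqrt t) T p ->
    `|similarity_solution h sigma p| <= M.
  exists (Num.sqrt T * (2 * h)) => p /(similarity_solution_bounded h0)/andP[v0 v1].
  by rewrite ger0_norm.
have cv := @similarity_solution_within R T h sigma h0.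
have cs : continuous (fun t : R => sigma * Num.sqrt t).
  by move=> t; apply: cvgM; [exact: cvg_cst|exact: sqrt_continuous].
have s0 : sigma * Num.sqrt 0 = 0 by rewrite sqrtr0 mulr0.
have vS p : Slat (fun t => sigma * Num.sqrt t) T p ->
    u p = similarity_solution h sigma p.
  by move=> Sp; rewrite uS//; case: (similarity_solution_lateral h Sp).
have v0 p : initial_slice 0 p -> u p = similarity_solution h sigma p.
  case: p => x t [/= t0 x0]; rewrite similarity_solution_initial// t0.
  exact: u0.
move=> p [[Qp|/vS//]|/v0//]; apply/le_anti/andP; split.
- apply: (heat_dirichlet_le cs s0 du dv eu ev bu bv _ _ cu cv Qp) => q.
    by move/vS ->.
  by move/v0 ->.
- apply: (heat_dirichlet_le cs s0 dv du ev eu bv bu _ _ cv cu Qp) => q.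
    by move/vS ->.
  by move/v0 ->.
Qed.

(** The slope condition read on the similarity solution, to which the given
solution is equal; a single time, here [T / 2], is enough. *)
Lemma free_boundary_ratio (R : realType) (alpha T h sigma : R)
    (u : R * R -> R) : 0 < alpha -> 0 < T -> 0 < h ->
  bounded_ivp_solution (fun p => h / Num.sqrt p.2) alpha T 0 (fun=> 0)
    (fun t => sigma * Num.sqrt t) u ->
  tail_ratio sigma = 2 * h / alpha.
Proof.
move=> a0 T0 h0 sol; have uE := similarity_solution_unique h0 sol.
have [[_ [_ [ux [uxx [ut [du _ _ uxS]]]]]] _ _ _ _] := sol.
pose t := T / 2; pose x := sigma * Num.sqrt t.
have tT : 0 < t < T by rewrite divr_gt0// gtr_pMr// invf_lt1// ltr1n.
have Sx : Slat (fun t => sigma * Num.sqrt t) T (x, t) by split.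
have du1 := cd_ux_bd du Sx.
have dv1 := cd_ux_bd (similarity_solution_derivatives T h sigma) Sx.
have uvx : ux (x, t) = similarity_solution_x h sigma (x, t).
  apply: (cvg_unique _ du1); first exact: Rhausdorff.
  apply: cvg_trans dv1; apply: near_eq_cvg.
  near=> e; have e0 : 0 < e by near: e; exact: nbhs_right_gt.
  rewrite -(uE (x, t)); last by left; right.
  rewrite -(uE (x + e, t))//; left; left; split => //.
  by rewrite /Ddom/= in_itv/= andbT ltrDl.
have := uxS _ Sx; rewrite uvx.
have [_ ->] := similarity_solution_lateral h Sx => /oppr_inj <-.
by rewrite invf_div mulrCA divff ?mulr1// gt_eqF// mulr_gt0.
Unshelve. all: by end_near. Qed.

Theorem theorem4p1 (R : realType) (alpha T : R) (halpha : 0 < alpha)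
    (hT : 0 < T) :
  let is_sol (h sigma : R) (u : R * R -> R) :=
    bounded_ivp_solution (fun p => h / Num.sqrt p.2) alpha T 0 (fun=> 0)
      (fun t => sigma * Num.sqrt t) u in
  exists sigma : R -> R,
    [/\ forall h : R, 0 < h ->
          exists2 u : R * R -> R, is_sol h (sigma h) u &
            forall (sigma' : R) (u' : R * R -> R), is_sol h sigma' u' ->
              sigma' = sigma h /\
              (forall p, solution_domain (fun t => sigma h * Num.sqrt t) T 0 p ->
                 u' p = u p),
        forall h1 h2 : R, 0 < h1 -> h1 < h2 -> sigma h2 < sigma h1,
        smooth_on [set h | 0 < h] sigma,
        sigma (alpha / Num.sqrt pi) = 0
      & forall h : R, 0 < h ->
          (sigma h < 0 <-> alpha / Num.sqrt pi < h) /\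
          (0 < sigma h <-> h < alpha / Num.sqrt pi)].
Proof.
move=> is_sol; pose k := 2 / alpha; have k0 : 0 < k by rewrite divr_gt0.
pose sigma h := tail_ratio_inv (k * h).
have sigmaE h : 0 < h -> tail_ratio (sigma h) = k * h.
  by move=> h0; rewrite tail_ratio_invK// mulr_gt0.
have q0 : 0 < Num.sqrt pi :> R by rewrite sqrtr_gt0 pi_gt0.
have ratio0 : tail_ratio 0 = k * (alpha / Num.sqrt pi).
  by rewrite tail_ratio0 /k; field; rewrite !gt_eqF.
exists sigma; split.
- move=> h h0; have sE : tail_ratio (sigma h) = 2 * h / alpha.
    by rewrite sigmaE// mulrAC.
  exists (similarity_solution h (sigma h)); first exact: similarity_solution_sol.
  move=> sigma' u' sol; have s'E : sigma' = sigma h.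
    by apply: tail_ratio_inj; rewrite sE; exact: free_boundary_ratio sol.
  by split => //; rewrite -s'E; exact: similarity_solution_unique sol.
- move=> h1 h2 h10 h12; have h20 := lt_trans h10 h12.
  by rewrite -tail_ratio_lt !sigmaE// ltr_pM2l.
- exact: smooth_tail_ratio_inv.
- by rewrite /sigma -ratio0 tail_ratioK.
- move=> h h0; rewrite -(tail_ratio_lt (sigma h)) -(tail_ratio_lt 0).
  by rewrite sigmaE// ratio0 !ltr_pM2l.
Qed.
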